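(* Let $d\ge 1$, $\sigma>0$ and $K>0$. For any $K$-subgaussian distribution $P$ on $\mathbb{R}^d$ and every $n\in\mathbb{N}$, $$\mathbb{E}_{P^{\otimes n}}\big\|\hat P_{S^n}\ast\mathcal{N}_\sigma-P\ast\mathcal{N}_\sigma\big\|_{\mathsf{TV}}\;\le\; \left(\frac{1}{\sqrt2}+\frac{K}{\sigma}\right)^{\frac d2}e^{\frac{3d}{16}}\,\frac{1}{\sqrt n}.$$
   Context: A distribution $P$ on $\mathbb{R}^d$ is $K$-subgaussian ($K>0$) if $X\sim P$ satisfies $\mathbb{E}\big[\exp(\alpha^T(X-\mathbb{E}X))\big]\le \exp\big(\tfrac12K^2\|\alpha\|^2\big)$ for all $\alpha\in\mathbb{R}^d$. $\mathcal{N}_\sigma=\mathcal{N}(0,\sigma^2\mathrm{I}_d)$; $S^n=(S_1,\dots,S_n)\sim P^{\otimes n}$; $\hat P_{S^n}=\frac1n\sum_{i=1}^n\delta_{S_i}$ is the empirical measure; $\ast$ is convolution of measures. $\|\mu-\nu\|_{\mathsf{TV}}=\sup_A|\mu(A)-\nu(A)|$ (supremum over measurable sets), which equals $\frac12\int|f-g|$ when $\mu,\nu$ have densities $f,g$. *)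

(* Defs.v *)
From HB Require Import structures.
From mathcomp Require Import all_boot all_order all_algebra.
From mathcomp Require Import all_classical all_reals all_analysis.
From mathcomp Require Import measurable_realfun.

Set Implicit Arguments.
Unset Strict Implicit.
Unset Printing Implicit Defensive.

Import Order.TTheory GRing.Theory Num.Theory.

Local Open Scope classical_set_scope.
Local Open Scope ring_scope.

(* The d-dimensional real space. Its measurable structure is the product of the
   Borel sigma-algebras of the coordinates, i.e. its Borel sigma-algebra;
   [measurableTypeR R] is [R] with the structure on which the library defines
   [lebesgue_measure] and [normal_prob]. *)
Notation rvec R d := (d.-tuple (measurableTypeR R)).

Section product_power.
Context d (T : measurableType d) (R : realType).

Definition tuple_cons n (z : T * n.-tuple T) : n.+1.-tuple T :=
  [tuple of z.1 :: z.2].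

Lemma measurable_tuple_cons n : measurable_fun [set: T * n.-tuple T]
  (@tuple_cons n).
Proof. exact: measurable_cons. Qed.

HB.instance Definition _ n :=
  isMeasurableFun.Build _ _ _ _ (@tuple_cons n) (measurable_tuple_cons (n:=n)).

Fixpoint power_prob (P : probability T R) (n : nat) :
    probability (n.-tuple T) R :=
  if n is m.+1 then distribution (P \x power_prob P m)%E (@tuple_cons m)
  else dirac [tuple].

(* The defining property of the n-fold product measure. *)
Lemma power_prob_box (P : probability T R) n (A : 'I_n -> set T) :
  (forall i, measurable (A i)) ->
  power_prob P n [set x | forall i, A i (tnth x i)] = (\prod_i P (A i))%E.
Proof.
elim: n => [|n IHn] in A * => mA.
  rewrite big_ord0 /= diracE (_ : _ \in _ = true)//.
  by apply/mem_set => -[].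
rewrite big_ord_recl -IHn; last by move=> i; exact: mA.
rewrite /= /distribution /pushforward.
rewrite -product_measure1E//; last first.
  rewrite (_ : mkset _ = \bigcap_(i in [set: 'I_n])
      ((fun x : n.-tuple T => tnth x i) @^-1` (A (lift ord0 i)))).
    apply: fin_bigcap_measurable => // i _.
    by rewrite -[X in measurable X]setTI; apply: measurable_tnth.
  by apply/seteqP; split=> [x Ax i _|x Ax i]; apply: Ax.
congr ((_ \x _)%E _); apply/seteqP; split=> -[x t] /=.
  move=> h; split=> [|i]; first by have := h ord0.
  by have := h (lift ord0 i); rewrite tnthS.
move=> [h0 h] i; case: (unliftP ord0 i) => [j|] -> //.
by rewrite tnthS.
Qed.

End product_power.

Section Euclidean.
Context (R : realType) (d : nat).
Implicit Types x y : rvec R d.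

Definition coord x (i : 'I_d) : R := tnth x i.

Definition vdot x y : R := \sum_(i < d) coord x i * coord y i.

Definition vnorm x : R := Num.sqrt (vdot x x).

Definition vadd (z : rvec R d * rvec R d) : rvec R d :=
  [tuple coord z.1 i + coord z.2 i | i < d].

Definition vsub x y : rvec R d := [tuple coord x i - coord y i | i < d].

Lemma measurable_coord i : measurable_fun [set: rvec R d] (coord ^~ i).
Proof. exact: measurable_tnth. Qed.

Lemma measurable_vadd : measurable_fun [set: rvec R d * rvec R d] vadd.
Proof.
apply/measurable_fun_tnthP => i.
rewrite (_ : _ \o _ = (fun z => coord z.1 i + coord z.2 i)); last first.
  by apply/funext => z; rewrite /= tnth_mktuple.
by apply: measurable_funD; apply: (measurableT_comp (measurable_coord i)).
Qed.

HB.instance Definition _ :=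
  isMeasurableFun.Build _ _ _ _ vadd measurable_vadd.

End Euclidean.

Section smoothed_empirical_measure.
Context (R : realType) (d : nat).
Implicit Types P : probability (rvec R d) R.

Definition has_mean P : Prop :=
  forall i : 'I_d, P.-integrable [set: rvec R d] (fun x => (coord x i)%:E).

Definition mean P : rvec R d :=
  [tuple fine (\int[P]_x (coord x i)%:E)%E | i < d].

(* The first conjunct makes [mean P] the genuine mean: [fine] of a divergent
   or undefined expectation is a meaningless value. *)
Definition subgaussian (K : R) P : Prop :=
  has_mean P /\
  forall a : rvec R d,
    (\int[P]_x (expR (vdot a (vsub x (mean P))))%:E
     <= (expR (2^-1 * K ^+ 2 * vnorm a ^+ 2))%:E)%E.

(* N(0, s^2 I_d): the law of d independent N(0, s^2) coordinates. The second
   argument of [normal_prob] is the standard deviation. *)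
Definition gaussian (s : R) : probability (rvec R d) R :=
  power_prob (normal_prob 0 s) d.

Definition empirical n (s : n.-tuple (rvec R d)) (A : set (rvec R d)) : \bar R :=
  ((n%:R^-1)%:E * \sum_(i < n) \d_(tnth s i) A)%E.

(* The law of X + Y for independent X ~ mu and Y ~ nu. *)
Definition convolution (mu nu : set (rvec R d) -> \bar R) :
    set (rvec R d) -> \bar R :=
  pushforward (mu \x nu)%E (@vadd R d).

Definition tv_dist (mu nu : set (rvec R d) -> \bar R) : \bar R :=
  ereal_sup [set `|mu A - nu A|%E | A in measurable].

End smoothed_empirical_measure.

Section empirical_measure.
Context (R : realType) (d n : nat) (s : n.-tuple (rvec R d)).

Let empiricalE : empirical s =
  mscale (n%:R^-1)%:nng (msum (fun k => dirac (nth point s k)) n).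
Proof.
apply/funext => A; rewrite /empirical /mscale /msum /=.
by congr (_ * _)%E; apply: eq_bigr => i _; rewrite (tnth_nth point).
Qed.

Let empirical0 : empirical s set0 = 0%E.
Proof. by rewrite empiricalE measure0. Qed.

Let empirical_ge0 A : (0 <= empirical s A)%E.
Proof. by rewrite empiricalE measure_ge0. Qed.

Let empirical_sigma_additive : semi_sigma_additive (empirical s).
Proof. by rewrite empiricalE; exact: measure_semi_sigma_additive. Qed.

HB.instance Definition _ := isMeasure.Build _ _ _ (empirical s)
  empirical0 empirical_ge0 empirical_sigma_additive.

End empirical_measure.

(* Main.v *)
From HB Require Import structures.
From mathcomp Require Import all_boot all_order all_algebra.
From mathcomp Require Import all_classical all_reals all_analysis.
From mathcomp Require Import measurable_realfun ring lra.
(* After the linear algebra, whose [coord] would otherwise hide the one meant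
   here. *)
Require Import Defs.

(** The proof compares both smoothed measures with one fixed Gaussian law and
    reduces the total variation distance to a variance.

    Write [s] for the smoothing scale, [m] for the mean of [P] and put
    [t^2 = s^2 + 2 K^2]. With [rho] the law of [N(0, t^2 I)], the law of
    [u + N(0, s^2 I)], translated by [-m], has a density [L u] with respect
    to [rho]: a product of one-dimensional likelihood ratios
    ([ge0_integral_gaussian_translate]). Hence the smoothed empirical measure
    has the density [x |-> n^-1 * sum_i L S_i x], the smoothed population
    measure has the density [p x = E L S x], and the total variation distance
    is at most the [rho]-integral of the absolute difference
    ([tv_dist_density_le]).

    For a fixed [x] this difference is an empirical mean minus its
    expectation, so its mean square is at most [E (L S x)^2 / n]
    ([integral_empirical_mean_sqr]). As the product of the sampling law and
    [rho] is a probability, the first absolute moment is bounded by the square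
    root of the second ([integral_norm_le_of_sqr]), and it remains to bound
    [E (int (L S x)^2 rho(dx))].

    The inner integral is Gaussian: with [w^2 = 2 t^2 - s^2] it equals
    [(t^2 / (s w))^d * exp (|S - m|^2 / w^2)] ([integral_gaussian_lr_sqr]).
    The expectation of the last factor is at most [(w / t)^d]
    ([subgaussian_expR_vdotxx]): [exp (|y|^2 / w^2)] is itself a Gaussian
    average of the exponentials [exp (a . y)], to which the subgaussian
    hypothesis applies. Altogether the second moment is at most [(t / s)^d],
    so the expected distance is at most [(t / s)^(d/2) / sqrt n]. The choice
    of [t] minimises the resulting bound, and
    [t / s = sqrt (1 + 2 (K/s)^2) <= sqrt 2 * (1 / sqrt 2 + K/s)] with
    [sqrt 2 <= exp (3/8)] gives the stated constant
    ([sqrt_ratio_le_constant]). *)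

Set Implicit Arguments.
Unset Strict Implicit.
Unset Printing Implicit Defensive.
Import Order.TTheory GRing.Theory Num.Theory.

Local Open Scope classical_set_scope.
Local Open Scope ring_scope.

(** * Integrals against a probability measure *)

(** The integral of a nonnegative function is a supremum over the simple
    functions below it, hence monotone on arbitrary functions. The total
    variation distance calls for this generality: as a supremum over
    uncountably many sets, its measurability in the sample is unclear. *)
Lemma ge0_le_integralT d (T : measurableType d) (R : realType)
  (mu : {measure set T -> \bar R}) (f g : T -> \bar R) :
  (forall x, 0 <= f x)%E -> (forall x, f x <= g x)%E ->
  (\int[mu]_x f x <= \int[mu]_x g x)%E.
Proof.
move=> f0 fg.
have g0 x : (0 <= g x)%E by exact: le_trans (fg x).
rewrite !ge0_integralTE//; apply: ereal_sup_le => _ [h hf <-].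
by exists h => // x; exact: le_trans (fg x).
Qed.

Lemma integral_prob_cst d (T : measurableType d) (R : realType)
  (P : probability T R) (c : R) : (\int[P]_x c%:E = c%:E)%E.
Proof.
rewrite integral_cst// -[RHS]mule1; congr (_ * _)%E.
exact: probability_setT.
Qed.

(** The case of the Cauchy-Schwarz inequality that the bound needs: integrate
    [`|f| <= f ^+ 2 / (2 c) + c / 2]. *)
Lemma integral_norm_le_of_sqr d (T : measurableType d) (R : realType)
  (P : probability T R) (f : T -> R) (c : R) :
  0 < c -> measurable_fun setT f ->
  (\int[P]_x (f x ^+ 2)%:E <= (c ^+ 2)%:E)%E ->
  (\int[P]_x `|f x|%:E <= c%:E)%E.
Proof.
move=> c0 mf fc.
have mf2 : measurable_fun setT (fun x => (f x ^+ 2)%:E).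
  by apply/measurable_EFinP; exact: measurable_funX.
have f20 x : (0 <= (f x ^+ 2)%:E)%E by rewrite lee_fin sqr_ge0.
have c20 : 0 <= (c *+ 2)^-1 by rewrite invr_ge0 mulrn_wge0// ltW.
apply: (@le_trans _ _
    (\int[P]_x (((c *+ 2)^-1)%:E * (f x ^+ 2)%:E + (c / 2)%:E))%E).
  apply: ge0_le_integralT => x; first by rewrite lee_fin.
  rewrite -EFinM -EFinD lee_fin.
  have -> : (c *+ 2)^-1 * f x ^+ 2 + c / 2 =
      `|f x| + (c *+ 2)^-1 * (`|f x| - c) ^+ 2.
    by rewrite -(real_normK (num_real (f x))); field; rewrite gt_eqF.
  by rewrite lerDl mulr_ge0// sqr_ge0.
rewrite ge0_integralD//; last 3 first.
- by move=> x _; rewrite mule_ge0// lee_fin.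
- exact: measurable_funeM.
- by move=> x _; rewrite lee_fin divr_ge0// ltW.
rewrite ge0_integralZl// integral_prob_cst.
apply: le_trans (_ : (((c *+ 2)^-1)%:E * (c ^+ 2)%:E + (c / 2)%:E <= _)%E).
  by apply: leeD => //; apply: lee_pmul => //; exact: integral_ge0.
rewrite -EFinM -EFinD lee_fin le_eqVlt; apply/orP; left; apply/eqP.
by field; rewrite gt_eqF.
Qed.

(** * Integration over a finite power of a probability measure *)

Section tuple_cons.
Context d (T : measurableType d) (n : nat).

Lemma tnth_tuple_cons0 (x : T) (s : n.-tuple T) :
  tnth (tuple_cons (x, s)) ord0 = x.
Proof. by []. Qed.

Lemma tnth_tuple_consS (x : T) (s : n.-tuple T) i :
  tnth (tuple_cons (x, s)) (lift ord0 i) = tnth s i.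
Proof. by rewrite tnthS. Qed.

End tuple_cons.

Section power.
Context d (T : measurableType d) (R : realType) (P : probability T R).
Local Open Scope ereal_scope.

Lemma integral_power_prob0 (f : 0.-tuple T -> \bar R) :
  measurable_fun setT f -> \int[power_prob P 0]_s f s = f [tuple].
Proof. by move=> mf; rewrite integral_dirac// diracT mul1e. Qed.

Lemma measurable_fun_tuple_cons n (f : n.+1.-tuple T -> \bar R) :
  measurable_fun setT f -> measurable_fun setT (f \o @tuple_cons _ T n).
Proof.
by move=> mf; apply: (measurableT_comp mf); exact: measurable_tuple_cons.
Qed.

Lemma ge0_integral_power_probS n (f : n.+1.-tuple T -> \bar R) :
  measurable_fun setT f -> (forall s, 0 <= f s) ->
  \int[power_prob P n.+1]_s f s =
  \int[P]_x \int[power_prob P n]_s f (tuple_cons (x, s)).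
Proof.
move=> mf f0.
rewrite /= ge0_integral_pushforward//.
rewrite preimage_setT fubini_tonelli1//.
- exact: measurable_fun_tuple_cons.
- by move=> z; exact: f0.
Qed.

Lemma measurable_prod_tnth n (f : 'I_n -> T -> R) :
  (forall i, measurable_fun setT (f i)) ->
  measurable_fun setT (fun s : n.-tuple T => \prod_(i < n) f i (tnth s i))%R.
Proof.
move=> mf; apply: measurable_prod => i _.
by apply: (measurableT_comp (mf i)); exact: measurable_tnth.
Qed.

Lemma integral_power_prob_prod n (f : 'I_n -> T -> R) (c : 'I_n -> R) :
  (forall i, measurable_fun setT (f i)) -> (forall i x, 0 <= f i x)%R ->
  (forall i, \int[P]_x (f i x)%:E = (c i)%:E) ->
  \int[power_prob P n]_s (\prod_(i < n) f i (tnth s i))%:E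
  = (\prod_(i < n) c i)%:E.
Proof.
elim: n => [|n IHn] in f c *.
  move=> mf _ _; rewrite integral_power_prob0 ?big_ord0//.
  by apply/measurable_EFinP; exact: measurable_prod_tnth.
move=> mf f0 fc.
rewrite ge0_integral_power_probS//; last 2 first.
  by apply/measurable_EFinP; exact: measurable_prod_tnth.
  by move=> s; rewrite lee_fin prodr_ge0.
transitivity (\int[P]_x ((f ord0 x)%:E * (\prod_(i < n) c (lift ord0 i))%:E)).
  apply: eq_integral => x _.
  rewrite -(IHn (fun i => f (lift ord0 i)))//.
  rewrite -ge0_integralZl//.
  - apply: eq_integral => s _; rewrite big_ord_recl tnth_tuple_cons0 EFinM.
    by congr (_ * _%:E); apply: eq_bigr => i _; rewrite tnth_tuple_consS.
  - apply/measurable_EFinP.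
    exact: (measurable_prod_tnth (f := fun i => f (lift ord0 i))).
  - by move=> s _; rewrite lee_fin prodr_ge0.
  - by rewrite lee_fin.
rewrite ge0_integralZr//.
- by rewrite fc big_ord_recl -EFinM.
- exact/measurable_EFinP.
- by move=> x _; rewrite lee_fin.
- rewrite lee_fin prodr_ge0// => i _; rewrite -lee_fin -fc.
  by apply: integral_ge0 => x _; rewrite lee_fin.
Qed.

End power.

(** * Mean square error of an empirical mean *)

Section empirical_mean.
Context d (T : measurableType d) (R : realType) (P : probability T R).

(** Bienayme's identity for centred independent terms. The offset [a] makes
    the induction go through: peeling off one coordinate [x] turns [a] into
    [a + g x], and the cross term [2 a g x] integrates to zero. *)
Lemma integral_power_prob_sqr_sum n (g : T -> R) (V a : R) :
  P.-integrable setT (EFin \o g) ->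
  P.-integrable setT (fun x => (g x ^+ 2)%:E) ->
  (\int[P]_x (g x)%:E = 0)%E -> (\int[P]_x (g x ^+ 2)%:E = V%:E)%E ->
  (\int[power_prob P n]_s ((a + \sum_(i < n) g (tnth s i)) ^+ 2)%:E
   = (a ^+ 2 + n%:R * V)%:E)%E.
Proof.
move=> ig ig2 g0 gV.
have mg : measurable_fun setT g.
  by apply/measurable_EFinP; exact: measurable_int ig.
have msum m : measurable_fun [set: m.-tuple T]
    (fun s => \sum_(i < m) g (tnth s i)).
  apply: measurable_sum => i.
  exact: (measurableT_comp mg (@measurable_tnth _ T m i)).
have msqr m b : measurable_fun [set: m.-tuple T]
    (fun s => ((b + \sum_(i < m) g (tnth s i)) ^+ 2)%:E).
  apply/measurable_EFinP; apply: measurable_funX.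
  by apply: measurable_funD => //; exact: msum.
elim: n a => [|n IHn] a.
  by rewrite integral_power_prob0//= big_ord0 addr0 mul0r addr0.
rewrite ge0_integral_power_probS//; last by move=> s; rewrite lee_fin sqr_ge0.
transitivity (\int[P]_x ((a ^+ 2 + n%:R * V)%:E
  + ((a *+ 2)%:E * (g x)%:E + (g x ^+ 2)%:E)))%E.
  apply: eq_integral => x _.
  under eq_integral => s _.
    rewrite big_ord_recl tnth_tuple_cons0 addrA.
    under eq_bigr do rewrite tnth_tuple_consS.
    over.
  by rewrite IHn -EFinM -!EFinD; congr EFin; ring.
rewrite integralD//; last 2 first.
- exact: finite_measure_integrable_cst.
- by apply: integrableD => //; exact: integrableZl.
rewrite integral_prob_cst integralD//; last exact: integrableZl.
rewrite integralZl// g0 mule0 add0e gV -EFinD; congr EFin.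
by rewrite -natr1; ring.
Qed.

(** The variance of [f] is at most its second moment. *)
Lemma integral_empirical_mean_sqr n (f : T -> R) (p : R) : (0 < n)%N ->
  P.-integrable setT (EFin \o f) ->
  P.-integrable setT (fun x => (f x ^+ 2)%:E) ->
  (\int[P]_x (f x)%:E = p%:E)%E ->
  (\int[power_prob P n]_s ((n%:R^-1 * \sum_(i < n) f (tnth s i) - p) ^+ 2)%:E
   <= (n%:R^-1)%:E * \int[P]_x (f x ^+ 2)%:E)%E.
Proof.
move=> n0 iF iF2 fp.
have n0' : n%:R != 0 :> R by rewrite pnatr_eq0 -lt0n.
have [F fF] : exists F, (\int[P]_x (f x ^+ 2)%:E = F%:E)%E.
  exists (fine (\int[P]_x (f x ^+ 2)%:E)%E); rewrite fineK//.
  exact: integrable_fin_num.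
pose g x := f x - p.
have ic : P.-integrable setT (EFin \o cst p).
  exact: finite_measure_integrable_cst.
have ig : P.-integrable setT (EFin \o g).
  by have := @integrableB _ _ _ P setT measurableT _ _ iF ic.
have g2E : (fun x => (g x ^+ 2)%:E) =
    (fun x => (p ^+ 2)%:E + ((- p *+ 2)%:E * (f x)%:E + (f x ^+ 2)%:E))%E.
  by apply/funext => x; rewrite -EFinM -!EFinD /g; congr EFin; ring.
have ic2 : P.-integrable setT (cst (p ^+ 2)%:E).
  exact: finite_measure_integrable_cst.
have iM : P.-integrable setT (fun x => (- p *+ 2)%:E * (f x)%:E)%E.
  exact: integrableZl.
have iD : P.-integrable setT
    (fun x => (- p *+ 2)%:E * (f x)%:E + (f x ^+ 2)%:E)%E.
  exact: integrableD.
have ig2 : P.-integrable setT (fun x => (g x ^+ 2)%:E).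
  by rewrite g2E; exact: integrableD.
have g0 : (\int[P]_x (g x)%:E = 0)%E.
  rewrite (_ : (fun x => (g x)%:E) = (fun x => (f x)%:E - (cst p%:E) x)%E)//.
  by rewrite integralB// fp integral_prob_cst subee.
have gV : (\int[P]_x (g x ^+ 2)%:E = (F - p ^+ 2)%:E)%E.
  rewrite g2E integralD// integralD// integralZl// fp fF integral_prob_cst.
  by rewrite -EFinM -!EFinD; congr EFin; ring.
have E := @integral_power_prob_sqr_sum n g _ 0 ig ig2 g0 gV.
rewrite (_ : (fun s : n.-tuple T => _) = (fun s =>
   (n%:R ^- 2)%:E * ((0 + \sum_(i < n) g (tnth s i)) ^+ 2)%:E)%E); last first.
  apply/funext => s; rewrite -EFinM add0r; congr EFin.
  rewrite sumrB sumr_const card_ord -[p *+ n]mulr_natl; field; exact: n0'.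
rewrite ge0_integralZl//; last 2 first.
- apply/measurable_EFinP; apply: measurable_funX; apply: measurable_funD => //.
  apply: measurable_sum => i.
  have mg : measurable_fun setT g.
    by apply/measurable_EFinP; exact: measurable_int ig.
  exact: (measurableT_comp mg (@measurable_tnth _ T n i)).
- by move=> s _; rewrite lee_fin sqr_ge0.
rewrite E fF -!EFinM lee_fin expr0n add0r.
rewrite (_ : n%:R ^- 2 * _ = n%:R^-1 * (F - p ^+ 2)); last by field; exact: n0'.
by rewrite ler_wpM2l ?invr_ge0// gerBl sqr_ge0.
Qed.

End empirical_mean.

(** * One-dimensional Gaussian integrals *)

Section onedim.
Context (R : realType).
Local Notation leb := (@lebesgue_measure R).
Implicit Types (f : measurableTypeR R -> \bar R) (m s u : R).
Local Open Scope ereal_scope.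

Let translate u (x : measurableTypeR R) : measurableTypeR R := (u + x)%R.

Let measurable_translate u : measurable_fun setT (translate u).
Proof. exact: measurable_funD. Qed.

HB.instance Definition _ u :=
  isMeasurableFun.Build _ _ _ _ (translate u) (measurable_translate u).

Lemma ge0_integral_lebesgue_shift f u :
  measurable_fun setT f -> (forall x, 0 <= f x) ->
  \int[leb]_x f (u + x)%R = \int[leb]_x f x.
Proof.
move=> mf f0.
rewrite [LHS](_ : _ = \int[leb]_(x in translate u @^-1` setT)
  (f \o translate u) x)//.
rewrite -ge0_integral_pushforward//.
apply: eq_measure_integral => A mA _.
apply/esym/lebesgue_measure_unique => //= _ [[a b]] _ <-.
rewrite /pushforward.
rewrite (_ : _ @^-1` _ = `]a - u, b - u]%classic)%R; last first.
  by apply/seteqP; split => x /=; rewrite /translate !in_itv/= ltrBlDl lerBrDl.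
rewrite !lebesgue_measure_itv/= !lte_fin ltrD2r.
by case: ifP => // _; rewrite -!EFinB; congr EFin; ring.
Qed.

(** [normal_prob] is defined by integrating [normal_pdf] over sets, which
    makes that function a version of its Radon-Nikodym derivative. *)
Lemma ge0_integral_normal_prob m s f :
  measurable_fun setT f -> (forall x, 0 <= f x) ->
  \int[normal_prob m s]_x f x = \int[leb]_x (f x * (normal_pdf m s x)%:E).
Proof.
move=> mf f0.
have dom := normal_prob_dominates m s.
rewrite -(Radon_Nikodym_SigmaFinite.change_of_variables dom)//=.
have mp : measurable_fun [set: measurableTypeR R]
    (fun x => (normal_pdf m s x)%:E).
  by apply/measurable_EFinP; exact: measurable_normal_pdf.
have fi := Radon_Nikodym_SigmaFinite.f_integrable dom.
apply: ae_eq_integral => //.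
- apply: emeasurable_funM => //; exact: measurable_int fi.
- exact: emeasurable_funM.
- apply: ae_eqe_mul2l; apply: integral_ae_eq => //.
  by move=> E _ mE; rewrite -Radon_Nikodym_SigmaFinite.f_integral.
Qed.

End onedim.

Section normal.
Context (R : realType).
Implicit Types (a c m s t u w x y : R).

Lemma normal_pdfE_expR m s x : 0 < s -> normal_pdf m s x =
  (s * Num.sqrt (pi *+ 2))^-1 * expR (- ((x - m) ^+ 2 / (s ^+ 2 *+ 2))).
Proof.
move=> s0; rewrite normal_pdfE ?gt_eqF// /normal_peak /normal_fun mulNr.
by rewrite -mulrnAr sqrtrM ?sqr_ge0// sqrtr_sqr gtr0_norm.
Qed.

Let sqrt_2pi_neq0 : Num.sqrt (pi *+ 2) != 0 :> R.
Proof. by rewrite gt_eqF// sqrtr_gt0 mulrn_wgt0// pi_gt0. Qed.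

Lemma normal_pdf_gt0 m s x : 0 < s -> 0 < normal_pdf m s x.
Proof.
move=> s0; rewrite normal_pdfE_expR// mulr_gt0 ?expR_gt0// invr_gt0.
by rewrite mulr_gt0// sqrtr_gt0 mulrn_wgt0// pi_gt0.
Qed.

(** All the Gaussian integrals below come from completing the square: the
    integrand times the density is a multiple of another normal density. *)
Lemma integral_normal_prob_eq m s m' s' c (f : measurableTypeR R -> R) :
  measurable_fun setT f -> (forall x, 0 <= f x) -> 0 <= c ->
  (forall x, f x * normal_pdf m s x = c * normal_pdf m' s' x) ->
  (\int[normal_prob m s]_x (f x)%:E = c%:E)%E.
Proof.
move=> mf f0 c0 fc; rewrite ge0_integral_normal_prob//; last first.
  exact/measurable_EFinP.
under eq_integral do rewrite -EFinM fc EFinM.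
rewrite ge0_integralZl//=.
- by rewrite integral_normal_pdf mule1.
- by apply/measurable_EFinP; exact: measurable_normal_pdf.
- by move=> x _; rewrite lee_fin normal_pdf_ge0.
Qed.

Lemma integral_normal_prob_expR s y : 0 < s ->
  (\int[normal_prob 0 s]_x (expR (x * y))%:E
   = (expR (s ^+ 2 * y ^+ 2 / 2))%:E)%E.
Proof.
move=> s0; apply: (@integral_normal_prob_eq _ _ (s ^+ 2 * y) s).
- by apply: measurableT_comp => //; exact: measurable_funM.
- by move=> x; exact: expR_ge0.
- exact: expR_ge0.
move=> x; rewrite !normal_pdfE_expR// mulrCA [RHS]mulrCA -!expRD.
congr (_ * expR _); field; exact: lt0r_neq0.
Qed.

Lemma integral_normal_prob_expR_sqr s s' a : 0 < s -> 0 < s' ->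
  s ^- 2 = s' ^- 2 + a ->
  (\int[normal_prob 0 s]_x (expR (a * x ^+ 2 / 2))%:E = (s' / s)%:E)%E.
Proof.
move=> s0 s'0 ss'; apply: (@integral_normal_prob_eq _ _ 0 s').
- apply: measurableT_comp => //; apply: measurable_funM => //.
  by apply: measurable_funM => //; exact: measurable_funX.
- by move=> x; exact: expR_ge0.
- by rewrite divr_ge0 ?ltW.
move=> x; rewrite !normal_pdfE_expR// mulrCA -expRD [RHS]mulrA.
congr (_ * expR _).
  by field; rewrite sqrt_2pi_neq0 !gt_eqF.
have -> : a = s ^- 2 - s' ^- 2 by rewrite ss' addrC addKr.
by rewrite subr0; field; rewrite !gt_eqF.
Qed.

Definition likelihood_ratio s t u x := normal_pdf u s x / normal_pdf 0 t x.

Lemma likelihood_ratioE s t u x : 0 < s -> 0 < t -> likelihood_ratio s t u x =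
  t / s * expR (x ^+ 2 / (t ^+ 2 *+ 2) - (x - u) ^+ 2 / (s ^+ 2 *+ 2)).
Proof.
move=> s0 t0; rewrite /likelihood_ratio !normal_pdfE_expR// subr0.
rewrite expRD !expRN; set e1 := expR _; set e2 := expR _.
have [e10 e20] : e1 != 0 /\ e2 != 0 by rewrite /e1 /e2 !gt_eqF ?expR_gt0.
by field; rewrite sqrt_2pi_neq0 e10 e20 !gt_eqF.
Qed.

Lemma measurable_likelihood_ratio s t : 0 < s -> 0 < t ->
  measurable_fun [set: measurableTypeR R * measurableTypeR R]
    (fun z => likelihood_ratio s t z.1 z.2).
Proof.
move=> s0 t0.
rewrite (_ : (fun _ => _) = fun z : measurableTypeR R * measurableTypeR R =>
  t / s * expR (z.2 ^+ 2 / (t ^+ 2 *+ 2) - (z.2 - z.1) ^+ 2 / (s ^+ 2 *+ 2))).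
  apply: measurable_funM => //; apply: measurableT_comp => //.
  apply: measurable_funB; apply: measurable_funM => //;
    apply: measurable_funX => //.
  exact: measurable_funB.
apply/funext => z; rewrite likelihood_ratioE//.
Qed.

Lemma measurable_likelihood_ratio_r s t u : 0 < s -> 0 < t ->
  measurable_fun [set: measurableTypeR R] (likelihood_ratio s t u).
Proof.
move=> s0 t0; have mlr := measurable_likelihood_ratio s0 t0.
exact: (measurableT_comp mlr (pair1_measurable u)).
Qed.

Lemma likelihood_ratio_gt0 s t u x : 0 < s -> 0 < t ->
  0 < likelihood_ratio s t u x.
Proof. by move=> s0 t0; rewrite divr_gt0// normal_pdf_gt0. Qed.

(** A bound that does not depend on [u]: it makes the likelihood ratio
    integrable in [u] against every probability measure. *)
Lemma likelihood_ratio_le s t u x : 0 < s -> 0 < t ->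
  likelihood_ratio s t u x <= normal_peak s / normal_pdf 0 t x.
Proof.
move=> s0 t0; rewrite ler_pM2r ?invr_gt0 ?normal_pdf_gt0//.
by rewrite normal_pdf_ub// gt_eqF.
Qed.

Lemma ge0_integral_normal_prob_translate s t u
  (g : measurableTypeR R -> \bar R) :
  0 < s -> 0 < t -> measurable_fun setT g -> (forall x, 0 <= g x)%E ->
  (\int[normal_prob 0 s]_y g (u + y)%R =
   \int[normal_prob 0 t]_x (g x * (likelihood_ratio s t u x)%:E))%E.
Proof.
move=> s0 t0 mg g0.
have mlr := measurable_likelihood_ratio_r u s0 t0.
rewrite ge0_integral_normal_prob//; last first.
  by apply: (measurableT_comp mg); exact: measurable_funD.
pose k x := (g x * (likelihood_ratio s t u x)%:E)%E.
rewrite (@ge0_integral_normal_prob _ _ _ k); last 2 first.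
- by apply: emeasurable_funM => //; exact/measurable_EFinP.
- by move=> x; rewrite mule_ge0// lee_fin ltW// likelihood_ratio_gt0.
transitivity (\int[lebesgue_measure]_x (g x * (normal_pdf u s x)%:E))%E.
  pose h (x : measurableTypeR R) := (g x * (normal_pdf u s x)%:E)%E.
  have <- := @ge0_integral_lebesgue_shift R h u.
  - apply: eq_integral => x _; rewrite /h !normal_pdfE_expR//.
    by rewrite [(u + x)%R]addrC addrK subr0.
  - apply: emeasurable_funM => //; apply/measurable_EFinP.
    exact: measurable_normal_pdf.
  - by move=> x; rewrite mule_ge0// lee_fin normal_pdf_ge0.
apply: eq_integral => x _; rewrite -muleA -EFinM; congr (_ * _%:E)%E.
by rewrite divfK// gt_eqF// normal_pdf_gt0.
Qed.

(** The square of the translated density divided by the centred one is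
    proportional to a normal density of variance [(s t / w)^2], centred at
    [2 u t^2 / w^2]. *)
Lemma integral_likelihood_ratio_sqr s t w u : 0 < s -> 0 < t -> 0 < w ->
  w ^+ 2 = t ^+ 2 *+ 2 - s ^+ 2 ->
  (\int[normal_prob 0 t]_x (likelihood_ratio s t u x ^+ 2)%:E
   = (t ^+ 2 / (s * w) * expR (u ^+ 2 / w ^+ 2))%:E)%E.
Proof.
move=> s0 t0 w0 wE.
have v0 : 0 < s * t / w by rewrite divr_gt0// mulr_gt0.
apply: (@integral_normal_prob_eq _ _ (u * t ^+ 2 *+ 2 / w ^+ 2) (s * t / w)).
- by apply: measurable_funX; exact: measurable_likelihood_ratio_r.
- by move=> x; rewrite sqr_ge0.
- by rewrite mulr_ge0 ?expR_ge0// divr_ge0 ?sqr_ge0// mulr_ge0// ltW.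
move=> x; rewrite likelihood_ratioE// !normal_pdfE_expR// exprMn -expRM_natl.
rewrite mulrACA [RHS]mulrACA -!expRD; congr (_ * expR _).
  by field; rewrite sqrt_2pi_neq0 !gt_eqF.
rewrite subr0 !exprMn exprVn.
have -> : s ^+ 2 = t ^+ 2 *+ 2 - w ^+ 2 by rewrite wE subKr.
have T0 : t ^+ 2 != 0 by rewrite gt_eqF// exprn_gt0.
have W0 : w ^+ 2 != 0 by rewrite gt_eqF// exprn_gt0.
have S0 : t ^+ 2 *+ 2 - w ^+ 2 != 0 by rewrite wE subKr gt_eqF// exprn_gt0.
move: (t ^+ 2) (w ^+ 2) T0 W0 S0 => T W T0 W0 S0.
by field; rewrite W0 T0 mulr_natr.
Qed.

End normal.

(** * Gaussian exponential moments and the subgaussian case *)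

Section gaussian_moments.
Context (R : realType) (d : nat).
Implicit Types (x y u : rvec R d) (s t w K : R).

Lemma expR_vdot x y :
  expR (vdot x y) = \prod_(i < d) expR (coord x i * coord y i).
Proof. exact: expR_sum. Qed.

Lemma vdotxx_ge0 x : 0 <= vdot x x.
Proof. by apply: sumr_ge0 => i _; rewrite -expr2 sqr_ge0. Qed.

Lemma sqr_vnorm x : vnorm x ^+ 2 = vdot x x.
Proof. by rewrite sqr_sqrtr// vdotxx_ge0. Qed.

Lemma integral_gaussian_expR_vdot s y : 0 < s ->
  (\int[gaussian d s]_x (expR (vdot x y))%:E
   = (expR (s ^+ 2 * vdot y y / 2))%:E)%E.
Proof.
move=> s0; under eq_integral do rewrite expR_vdot.
rewrite (@integral_power_prob_prod _ _ _ _ d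
  (fun i (r : measurableTypeR R) => expR (r * coord y i))
  (fun i => expR (s ^+ 2 * coord y i ^+ 2 / 2))).
- rewrite -expR_sum; congr (expR _)%:E.
  rewrite mulr_sumr mulr_suml; apply: eq_bigr => i _; by rewrite expr2.
- by move=> i; apply: measurableT_comp => //; exact: measurable_funM.
- by move=> i x; exact: expR_ge0.
- by move=> i; exact: integral_normal_prob_expR.
Qed.

Lemma integral_gaussian_expR_vdotxx s s' a : 0 < s -> 0 < s' ->
  s ^- 2 = s' ^- 2 + a ->
  (\int[gaussian d s]_x (expR (a * vdot x x / 2))%:E = ((s' / s) ^+ d)%:E)%E.
Proof.
move=> s0 s'0 ss'.
under eq_integral => x _.
  rewrite (_ : expR _ = \prod_(i < d) expR (a * coord x i ^+ 2 / 2));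
    last first.
    rewrite -expR_sum; congr expR; rewrite mulr_sumr mulr_suml.
    by apply: eq_bigr => i _; rewrite expr2.
  over.
rewrite (@integral_power_prob_prod _ _ _ _ d
  (fun i (r : measurableTypeR R) => expR (a * r ^+ 2 / 2))
  (fun=> s' / s)).
- by rewrite prodr_const card_ord.
- move=> i; apply: measurableT_comp => //; apply: measurable_funM => //.
  by apply: measurable_funM => //; exact: measurable_funX.
- by move=> i x; exact: expR_ge0.
- by move=> i; exact: integral_normal_prob_expR_sqr.
Qed.

Lemma measurable_vdot :
  measurable_fun [set: rvec R d * rvec R d] (fun z => vdot z.1 z.2).
Proof.
apply: measurable_sum => i.
have mc := @measurable_coord R d i.
apply: measurable_funM.
  exact: (measurableT_comp mc measurable_fst).
exact: (measurableT_comp mc measurable_snd).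
Qed.

Lemma measurable_vsub (m : rvec R d) :
  measurable_fun [set: rvec R d] (fun x => vsub x m).
Proof.
apply/measurable_fun_tnthP => i.
rewrite (_ : _ \o _ = fun x => coord x i - coord m i); last first.
  by apply/funext => x; rewrite /= tnth_mktuple.
by apply: measurable_funB => //; exact: measurable_coord.
Qed.

(** Gaussian linearisation: [exp (|y|^2 / w^2)] is the average of
    [exp (g . y)] over [g ~ N(0, (2 / w^2) I)]. Exchanging this average with
    the expectation over [P] lets the subgaussian bound replace [exp (g . y)]
    by [exp (K^2 |g|^2 / 2)], whose Gaussian average is [(w / t)^d]. *)
Lemma subgaussian_expR_vdotxx K t w (P : probability (rvec R d) R) :
  0 < t -> 0 < w -> w ^+ 2 = t ^+ 2 + K ^+ 2 *+ 2 -> subgaussian K P ->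
  (\int[P]_x (expR (vdot (vsub x (mean P)) (vsub x (mean P)) / w ^+ 2))%:E
   <= ((w / t) ^+ d)%:E)%E.
Proof.
move=> t0 w0 wE [_ subP].
(* [s] is the scale of the linearising Gaussian and [s'] that of the Gaussian
   obtained from it by the factor [exp (K^2 |g|^2 / 2)]. *)
pose s := Num.sqrt 2 / w.
pose s' := Num.sqrt 2 / t.
have s0 : 0 < s by rewrite divr_gt0 ?sqrtr_gt0.
have s'0 : 0 < s' by rewrite divr_gt0 ?sqrtr_gt0.
have sE : s ^+ 2 = 2 / w ^+ 2 by rewrite /s exprMn sqr_sqrtr// exprVn.
have s'E : s' ^+ 2 = 2 / t ^+ 2 by rewrite /s' exprMn sqr_sqrtr// exprVn.
pose c x := vsub x (mean P).
have mc : measurable_fun [set: rvec R d] c by exact: measurable_vsub.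
have mE : measurable_fun [set: rvec R d * rvec R d]
    (fun z => (expR (vdot z.2 (c z.1)))%:E).
  apply/measurable_EFinP; apply: measurableT_comp => //.
  have mc1 := measurableT_comp mc (@measurable_fst _ _ _ (rvec R d)).
  have mp := measurable_fun_pair (@measurable_snd _ _ (rvec R d) _) mc1.
  exact: (measurableT_comp measurable_vdot mp).
have E0 (z : rvec R d * rvec R d) : (0 <= (expR (vdot z.2 (c z.1)))%:E)%E.
  by rewrite lee_fin expR_ge0.
rewrite (_ : (\int[P]_x _ =
    \int[P]_x \int[gaussian d s]_y (expR (vdot y (c x)))%:E)%E); last first.
  apply: eq_integral => x _; rewrite integral_gaussian_expR_vdot// sE.
  by congr (expR _)%:E; rewrite /c; field; exact: lt0r_neq0.
have -> := @fubini_tonelli _ _ _ _ _ P (gaussian d s) _ mE E0.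
have <- : (\int[gaussian d s]_x (expR (K ^+ 2 * vdot x x / 2))%:E
    = ((w / t) ^+ d)%:E)%E.
  rewrite (integral_gaussian_expR_vdotxx s0 s'0).
    congr (_ ^+ d)%:E; rewrite /s /s'; field.
    by rewrite !gt_eqF// sqrtr_gt0.
  by rewrite -!exprVn !exprVn sE s'E !invf_div wE; field.
apply: ge0_le_integralT => y.
  by apply: integral_ge0 => x _; rewrite lee_fin expR_ge0.
apply: le_trans (subP y) _; rewrite lee_fin ler_expR sqr_vnorm.
by rewrite mulrC mulrA mulrC mulrA.
Qed.

End gaussian_moments.

(** * The translated Gaussian relative to a centred one *)

Section gaussian_likelihood_ratio.
Context (R : realType).
Implicit Types (s t w K : R).

(** The density of [N(u, s^2 I)] with respect to [N(0, t^2 I)]. *)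
Definition gaussian_lr d s t (u x : rvec R d) : R :=
  \prod_(i < d) likelihood_ratio s t (coord u i) (coord x i).

Lemma measurable_gaussian_lr d s t : 0 < s -> 0 < t ->
  measurable_fun [set: rvec R d * rvec R d]
    (fun z => gaussian_lr s t z.1 z.2).
Proof.
move=> s0 t0; apply: measurable_prod => i _.
have mc := @measurable_coord R d i.
have mp := measurable_fun_pair
  (measurableT_comp mc (@measurable_fst _ _ _ (rvec R d)))
  (measurableT_comp mc (@measurable_snd _ _ (rvec R d) _)).
exact: (measurableT_comp (measurable_likelihood_ratio s0 t0) mp).
Qed.

Lemma measurable_gaussian_lr_r d s t (u : rvec R d) : 0 < s -> 0 < t ->
  measurable_fun [set: rvec R d] (gaussian_lr s t u).
Proof.
move=> s0 t0; have mlr := @measurable_gaussian_lr d _ _ s0 t0.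
exact: (measurableT_comp mlr (pair1_measurable u)).
Qed.

Lemma gaussian_lr_gt0 d s t (u x : rvec R d) : 0 < s -> 0 < t ->
  0 < gaussian_lr s t u x.
Proof.
by move=> s0 t0; apply: prodr_gt0 => i _; exact: likelihood_ratio_gt0.
Qed.

Lemma gaussian_lr_le d s t (u x : rvec R d) : 0 < s -> 0 < t ->
  gaussian_lr s t u x
  <= \prod_(i < d) (normal_peak s / normal_pdf 0 t (coord x i)).
Proof.
move=> s0 t0; apply: ler_prod => i _.
by rewrite ltW ?likelihood_ratio_gt0//= likelihood_ratio_le.
Qed.

Lemma vadd_tuple_cons d (u0 y0 : measurableTypeR R) (u y : rvec R d) :
  vadd (tuple_cons (u0, u), tuple_cons (y0, y)) =
  tuple_cons ((u0 + y0 : measurableTypeR R), vadd (u, y)).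
Proof.
apply: eq_from_tnth => i; rewrite tnth_mktuple /coord/=.
by case: (unliftP ord0 i) => [j|] -> //; rewrite !tnthS tnth_mktuple.
Qed.

Lemma gaussian_lr_tuple_cons d s t
  (u0 x0 : measurableTypeR R) (u x : rvec R d) :
  gaussian_lr s t (tuple_cons (u0, u)) (tuple_cons (x0, x)) =
  likelihood_ratio s t u0 x0 * gaussian_lr s t u x.
Proof.
rewrite /gaussian_lr big_ord_recl; congr (_ * _).
by apply: eq_bigr => i _; rewrite /coord !tnth_tuple_consS.
Qed.

Lemma integral_gaussian_lr_sqr d s t w (u : rvec R d) :
  0 < s -> 0 < t -> 0 < w -> w ^+ 2 = t ^+ 2 *+ 2 - s ^+ 2 ->
  (\int[gaussian d t]_x (gaussian_lr s t u x ^+ 2)%:E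
   = ((t ^+ 2 / (s * w)) ^+ d * expR (vdot u u / w ^+ 2))%:E)%E.
Proof.
move=> s0 t0 w0 wE.
under eq_integral do rewrite /gaussian_lr -prodrXl.
rewrite (@integral_power_prob_prod _ _ _ _ d
  (fun i (r : measurableTypeR R) => likelihood_ratio s t (coord u i) r ^+ 2)
  (fun i => t ^+ 2 / (s * w) * expR (coord u i ^+ 2 / w ^+ 2))).
- rewrite big_split/= prodr_const card_ord -expR_sum mulr_suml.
  by congr (_ * expR _)%:E; apply: eq_bigr => i _; rewrite expr2.
- by move=> i; apply: measurable_funX; exact: measurable_likelihood_ratio_r.
- by move=> i x; exact: sqr_ge0.
- by move=> i; exact: integral_likelihood_ratio_sqr.
Qed.

(** Induction on the dimension: the induction hypothesis changes the measure
    in the last coordinates with the first one fixed, then the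
    one-dimensional statement changes it in the first coordinate. *)
Lemma ge0_integral_gaussian_translate d s t (u : rvec R d)
  (g : rvec R d -> \bar R) :
  0 < s -> 0 < t -> measurable_fun setT g -> (forall x, 0 <= g x)%E ->
  (\int[gaussian d s]_y g (vadd (u, y)) =
   \int[gaussian d t]_x (g x * (gaussian_lr s t u x)%:E))%E.
Proof.
move=> s0 t0; elim: d => [|d IHd] in u g *.
  move=> mg g0; rewrite !integral_power_prob0//=.
  - by rewrite /gaussian_lr big_ord0 mule1; congr g; apply: eq_from_tnth => -[].
  - apply: emeasurable_funM => //; apply/measurable_EFinP.
    exact: measurable_gaussian_lr_r.
  - apply: (measurableT_comp mg).
    exact: (measurableT_comp (@measurable_vadd R 0) (pair1_measurable u)).
move=> mg g0.
have [u0 [u' ->]] : exists u0 u', u = tuple_cons (u0, u').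
  case/tupleP: u => u0 u'; exists u0, u'; exact: val_inj.
pose k (z : measurableTypeR R * rvec R d) :=
  (g (tuple_cons z) * (gaussian_lr s t u' z.2)%:E)%E.
have mlr' : measurable_fun [set: rvec R d] (gaussian_lr s t u').
  exact: measurable_gaussian_lr_r.
have mk : measurable_fun [set: measurableTypeR R * rvec R d] k.
  apply: emeasurable_funM; first exact: measurable_fun_tuple_cons.
  apply/measurable_EFinP.
  exact: (measurableT_comp mlr' (@measurable_snd _ _ (measurableTypeR R) _)).
have k0 z : (0 <= k z)%E.
  by rewrite mule_ge0// lee_fin ltW// gaussian_lr_gt0.
pose H x0 := (\int[gaussian d t]_x k (x0, x))%E.
have mH : measurable_fun [set: measurableTypeR R] H.
  exact: (@measurable_fun_fubini_tonelli_F _ _ _ _ _ (gaussian d t) k).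
pose gv (y : rvec R d.+1) := g (vadd (tuple_cons (u0, u'), y)).
have mgv : measurable_fun setT gv.
  have mv := measurableT_comp (@measurable_vadd R d.+1)
    (pair1_measurable (tuple_cons (u0, u'))).
  exact: (measurableT_comp mg mv).
transitivity (\int[normal_prob 0 s]_y0 H (u0 + y0)%R)%E.
  have -> := @ge0_integral_power_probS _ _ _ (normal_prob 0 s) d gv mgv
    (fun=> g0 _).
  apply: eq_integral => y0 _.
  under eq_integral do rewrite /gv vadd_tuple_cons.
  pose a : measurableTypeR R := u0 + y0.
  rewrite (IHd u' (fun x => g (tuple_cons (a, x))))//.
  apply: (measurableT_comp (measurable_fun_tuple_cons mg)).
  exact: pair1_measurable.
have H0 x0 : (0 <= H x0)%E by apply: integral_ge0 => x _; exact: k0.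
rewrite (ge0_integral_normal_prob_translate u0 s0 t0 mH H0).
pose h x := (g x * (gaussian_lr s t (tuple_cons (u0, u')) x)%:E)%E.
rewrite (@ge0_integral_power_probS _ _ _ (normal_prob 0 t) d h); last 2 first.
- apply: emeasurable_funM => //; apply/measurable_EFinP.
  exact: measurable_gaussian_lr_r.
- by move=> x; rewrite mule_ge0// lee_fin ltW// gaussian_lr_gt0.
apply: eq_integral => x0 _; rewrite -ge0_integralZr//.
- apply: eq_integral => x _.
  rewrite /h /k gaussian_lr_tuple_cons [(likelihood_ratio _ _ _ _ * _)%R]mulrC.
  by rewrite -muleA -EFinM.
- exact: (measurableT_comp mk (pair1_measurable x0)).
- by rewrite lee_fin ltW// likelihood_ratio_gt0.
Qed.

(** With [w^2 = 2 t^2 - s^2 = t^2 + 2 K^2], the Gaussian integral contributes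
    [(t^2 / (s w))^d] and the subgaussian moment [(w / t)^d]; the choice of
    [t] cancels [w]. *)
Lemma subgaussian_gaussian_lr_sqr d K s t (P : probability (rvec R d) R) :
  0 < s -> 0 < t -> t ^+ 2 = s ^+ 2 + K ^+ 2 *+ 2 -> subgaussian K P ->
  (\int[P]_u \int[gaussian d t]_x
     (gaussian_lr s t (vsub u (mean P)) x ^+ 2)%:E
   <= ((t / s) ^+ d)%:E)%E.
Proof.
move=> s0 t0 tE subP.
have w2_gt0 : 0 < t ^+ 2 *+ 2 - s ^+ 2.
  rewrite tE; have : 0 < s ^+ 2 by rewrite exprn_gt0.
  by have := sqr_ge0 K; lra.
pose w := Num.sqrt (t ^+ 2 *+ 2 - s ^+ 2).
have w0 : 0 < w by rewrite sqrtr_gt0.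
have wE : w ^+ 2 = t ^+ 2 *+ 2 - s ^+ 2 by rewrite sqr_sqrtr// ltW.
have wE' : w ^+ 2 = t ^+ 2 + K ^+ 2 *+ 2 by rewrite wE tE; ring.
have c0 : 0 <= (t ^+ 2 / (s * w)) ^+ d.
  by rewrite exprn_ge0// divr_ge0 ?sqr_ge0// mulr_ge0 ?ltW.
under eq_integral do rewrite (integral_gaussian_lr_sqr _ s0 t0 w0 wE) EFinM.
rewrite ge0_integralZl//; last first.
  apply/measurable_EFinP; apply: measurableT_comp => //.
  apply: measurable_funM => //.
  have mc := @measurable_vsub R d (mean P).
  exact: (measurableT_comp (@measurable_vdot R d) (measurable_fun_pair mc mc)).
apply: le_trans (_ : (((t ^+ 2 / (s * w)) ^+ d)%:E * ((w / t) ^+ d)%:E <= _)%E).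
  apply: lee_pmul => //.
  - by apply: integral_ge0 => u _; rewrite lee_fin expR_ge0.
  - exact: subgaussian_expR_vdotxx wE' subP.
rewrite -EFinM -exprMn le_eqVlt; apply/orP; left; apply/eqP.
congr (_ ^+ d)%:E.
by field; rewrite !gt_eqF.
Qed.

End gaussian_likelihood_ratio.

(** * Total variation distance and densities *)

Lemma tv_dist_ge0 (R : realType) (d : nat) (mu nu : set (rvec R d) -> \bar R) :
  (0 <= tv_dist mu nu)%E.
Proof.
apply: (@le_trans _ _ (`|mu set0 - nu set0|)%E); first exact: abse_ge0.
by apply: ereal_sup_ubound; exists set0.
Qed.

(** Each difference of measures is the integral of [p - q] over a set. The map
    [phi] allows [p] and [q] to describe the measures after a change of
    variables. *)
Lemma tv_dist_density_le (R : realType) (d : nat)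
  (rho : probability (rvec R d) R)
  (phi : set (rvec R d) -> set (rvec R d))
  (mu nu : set (rvec R d) -> \bar R) (p q : rvec R d -> R) :
  (forall A, measurable A -> measurable (phi A)) ->
  rho.-integrable setT (EFin \o p) -> rho.-integrable setT (EFin \o q) ->
  (forall A, measurable A -> mu A = \int[rho]_(x in phi A) (p x)%:E)%E ->
  (forall A, measurable A -> nu A = \int[rho]_(x in phi A) (q x)%:E)%E ->
  (tv_dist mu nu <= \int[rho]_x `|p x - q x|%:E)%E.
Proof.
move=> mphi ip iq muE nuE; apply: ge_ereal_sup => _ [A mA <-].
have mB := mphi _ mA; rewrite muE// nuE//.
have ipB := integrableS measurableT mB (@subsetT _ _) ip.
have iqB := integrableS measurableT mB (@subsetT _ _) iq.
have ipq : rho.-integrable setT (EFin \o (fun x => p x - q x)).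
  by have := @integrableB _ _ _ rho setT measurableT _ _ ip iq.
have mpq := measurable_int _ ipq.
rewrite -integralB//; apply: le_trans (le_abse_integral _ _ _) _ => //.
  exact: measurable_funS mpq.
apply: ge0_subset_integral => //.
exact: measurableT_comp mpq.
Qed.

Lemma ge0_integral_empirical (R : realType) (d n : nat)
  (S : n.-tuple (rvec R d)) (f : rvec R d -> \bar R) :
  measurable_fun setT f -> (forall x, 0 <= f x)%E ->
  (\int[empirical S]_x f x = (n%:R^-1)%:E * \sum_(i < n) f (tnth S i))%E.
Proof.
move=> mf f0.
have -> : empirical S =
    mscale (n%:R^-1)%:nng (msum (fun k => dirac (nth point S k)) n).
  apply/funext => A; rewrite /empirical /mscale /msum /=.
  by congr (_ * _)%E; apply: eq_bigr => i _; rewrite (tnth_nth point).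
rewrite ge0_integral_mscale//= ge0_integral_measure_sum//; congr (_ * _)%E.
apply: eq_bigr => i _; rewrite integral_dirac// diracT mul1e.
by rewrite (tnth_nth point).
Qed.

(** * Densities of the two smoothed measures *)

Section translated_gaussian.
Context (R : realType) (d : nat) (s t : R).
Context (s0 : 0 < s) (t0 : 0 < t) (m : rvec R d).

(** Reading sets around [m] centres the law under study, so that one centred
    reference Gaussian, a power of a single law on the line, serves every
    mean. *)
Definition shift_set (A : set (rvec R d)) : set (rvec R d) :=
  [set x | A (vadd (m, x))].

Lemma measurable_shift_set A : measurable A -> measurable (shift_set A).
Proof.
move=> mA; rewrite -[X in measurable X]setTI.
exact: (measurableT_comp (@measurable_vadd R d) (pair1_measurable m)).
Qed.

Lemma vadd_vsub (u y : rvec R d) : vadd (m, vadd (vsub u m, y)) = vadd (u, y).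
Proof.
by apply: eq_from_tnth => i; rewrite !(tnth_mktuple, tnth_map)/= /coord
  !tnth_mktuple /coord/= tnth_mktuple addrA addrCA subrr addr0.
Qed.

Lemma gaussian_xsection (A : set (rvec R d)) u : measurable A ->
  gaussian d s (xsection (@vadd R d @^-1` A) u) =
  (\int[gaussian d t]_(x in shift_set A) (gaussian_lr s t (vsub u m) x)%:E)%E.
Proof.
move=> mA; have mB := measurable_shift_set mA.
have mX : measurable (xsection (@vadd R d @^-1` A) u).
  apply: measurable_xsection; rewrite -[X in measurable X]setTI.
  exact: measurable_vadd.
rewrite -[X in gaussian d s X]setIT -integral_indic//.
pose g (x : rvec R d) : \bar R := (\1_(shift_set A) x)%:E.
transitivity (\int[gaussian d s]_y g (vadd (vsub u m, y)))%E.
  apply: eq_integral => y _; congr (_%:E); rewrite !indicE.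
  congr (nat_of_bool _)%:R.
  apply/idP/idP; rewrite !inE /xsection/= ?inE /shift_set/= vadd_vsub//.
rewrite (ge0_integral_gaussian_translate (vsub u m) s0 t0); last 2 first.
- by apply/measurable_EFinP; exact: measurable_indic.
- by move=> x; rewrite lee_fin.
rewrite [RHS]integral_mkcond; apply: eq_integral => x _.
rewrite /g patchE indicE; case: ifPn => xA; by rewrite ?mul1e ?mul0e.
Qed.

End translated_gaussian.

Section smoothed_densities.
Context (R : realType) (d : nat) (s t : R).
Context (s0 : 0 < s) (t0 : 0 < t).
Context (P : probability (rvec R d) R) (m : rvec R d).
Local Notation rho := (gaussian d t).

(** The density, with respect to [rho], of [N(u, s^2 I)] translated by [-m]. *)
Definition kernel_density (u x : rvec R d) : R := gaussian_lr s t (vsub u m) x.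

Local Notation L := kernel_density.

Lemma measurable_kernel_density :
  measurable_fun [set: rvec R d * rvec R d] (fun z => L z.1 z.2).
Proof.
have mc := measurableT_comp (@measurable_vsub R d m)
  (@measurable_fst _ _ _ (rvec R d)).
have mp := measurable_fun_pair mc (@measurable_snd _ _ (rvec R d) (rvec R d)).
exact: (measurableT_comp (measurable_gaussian_lr s0 t0) mp).
Qed.

Lemma measurable_kernel_density_r u : measurable_fun [set: rvec R d] (L u).
Proof. exact: measurable_gaussian_lr_r. Qed.

Lemma measurable_kernel_density_l x : measurable_fun [set: rvec R d] (L ^~ x).
Proof.
exact: (measurableT_comp measurable_kernel_density (pair2_measurable x)).
Qed.

Lemma kernel_density_gt0 u x : 0 < L u x.
Proof. exact: gaussian_lr_gt0. Qed.

Lemma integral_kernel_density u : (\int[rho]_x (L u x)%:E = 1)%E.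
Proof.
have := gaussian_xsection s0 t0 m u (@measurableT _ (rvec R d)).
rewrite preimage_setT /shift_set (_ : [set x | _] = setT)// => <-.
rewrite -[RHS](@probability_setT _ _ _ (gaussian d s)); congr (gaussian d s _).
by apply/seteqP; split => // y _; rewrite /xsection/= inE.
Qed.

Lemma integrable_kernel_density_r u : rho.-integrable setT (EFin \o L u).
Proof.
apply/integrableP; split.
  by apply/measurable_EFinP; exact: measurable_kernel_density_r.
under eq_integral do rewrite /= ger0_norm ?(ltW (kernel_density_gt0 _ _))//.
by rewrite integral_kernel_density ltry.
Qed.

(** For a fixed [x] the density is bounded in [u], so the second moment at
    every single point [x] is finite, whatever [P] is. *)
Lemma integrable_kernel_density_expn k x :
  P.-integrable setT (fun u => (L u x ^+ k)%:E).
Proof.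
pose B := \prod_(i < d) (normal_peak s / normal_pdf 0 t (coord x i)).
apply: (@le_integrable _ _ _ P setT measurableT _ (EFin \o cst (B ^+ k))).
- apply/measurable_EFinP; apply: measurable_funX.
  exact: measurable_kernel_density_l.
- move=> u _; have L0 := ltW (kernel_density_gt0 u x).
  have LB : L u x <= B by exact: gaussian_lr_le.
  rewrite /= lee_fin !ger0_norm ?exprn_ge0 ?(le_trans L0 LB)//.
  by rewrite lerXn2r// nnegrE (le_trans L0 LB).
- exact: finite_measure_integrable_cst.
Qed.

Lemma integrable_kernel_density_l x : P.-integrable setT (EFin \o (L ^~ x)).
Proof. exact: (integrable_kernel_density_expn 1 x). Qed.

Definition smoothed_density (x : rvec R d) : R := fine (\int[P]_u (L u x)%:E)%E.

Local Notation p := smoothed_density.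

Lemma smoothed_densityE x : (\int[P]_u (L u x)%:E = (p x)%:E)%E.
Proof.
rewrite fineK//; apply: integrable_fin_num => //.
exact: integrable_kernel_density_l.
Qed.

Let mL : measurable_fun [set: rvec R d * rvec R d] (fun z => (L z.1 z.2)%:E).
Proof. by apply/measurable_EFinP; exact: measurable_kernel_density. Qed.

Let L0 (z : rvec R d * rvec R d) : (0 <= (L z.1 z.2)%:E)%E.
Proof. by rewrite lee_fin ltW// kernel_density_gt0. Qed.

Lemma smoothed_density_ge0 x : 0 <= p x.
Proof.
rewrite -lee_fin -smoothed_densityE.
by apply: integral_ge0 => u _; exact: (L0 (u, x)).
Qed.

Lemma measurable_smoothed_density : measurable_fun [set: rvec R d] p.
Proof.
apply/measurable_EFinP.
rewrite (_ : EFin \o p = fun x => (\int[P]_u (L u x)%:E)%E); last first.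
  by apply/funext => x; rewrite smoothed_densityE.
exact: (@measurable_fun_fubini_tonelli_G _ _ _ _ _ P _ mL L0).
Qed.

Lemma integral_smoothed_density B : measurable B ->
  (\int[rho]_(x in B) (p x)%:E
   = \int[P]_u \int[rho]_(x in B) (L u x)%:E)%E.
Proof.
move=> mB.
pose f (z : rvec R d * rvec R d) := ((L z.1 z.2)%:E * (\1_B z.2)%:E)%E.
have mf : measurable_fun setT f.
  have mI : measurable_fun [set: rvec R d] (\1_B : rvec R d -> R).
    exact: measurable_indic.
  apply: emeasurable_funM => //; apply/measurable_EFinP.
  exact: (measurableT_comp mI (@measurable_snd _ _ (rvec R d) (rvec R d))).
have f0 z : (0 <= f z)%E by rewrite mule_ge0.
have restrE (h : rvec R d -> \bar R) : (\int[rho]_(x in B) h x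
    = \int[rho]_x (h x * (\1_B x)%:E))%E.
  rewrite integral_mkcond; apply: eq_integral => x _.
  by rewrite patchE indicE; case: ifPn => _; rewrite ?mule1 ?mule0.
transitivity (\int[rho]_x \int[P]_u f (u, x))%E.
  rewrite restrE; apply: eq_integral => x _.
  rewrite -smoothed_densityE -ge0_integralZr//.
  - by apply/measurable_EFinP; exact: measurable_kernel_density_l.
  - by move=> u _; exact: (L0 (u, x)).
have <- := @fubini_tonelli _ _ _ _ _ P rho f mf f0.
by apply: eq_integral => u _; rewrite restrE.
Qed.

Lemma integrable_smoothed_density : rho.-integrable setT (EFin \o p).
Proof.
apply/integrableP; split.
  by apply/measurable_EFinP; exact: measurable_smoothed_density.
under eq_integral do rewrite /= ger0_norm ?smoothed_density_ge0//.
rewrite integral_smoothed_density//.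
under eq_integral do rewrite integral_kernel_density.
by rewrite integral_prob_cst ltry.
Qed.

Lemma convolution_smoothed_density A : measurable A ->
  convolution P (gaussian d s) A = (\int[rho]_(x in shift_set m A) (p x)%:E)%E.
Proof.
move=> mA; rewrite integral_smoothed_density//; last first.
  exact: measurable_shift_set.
by apply: eq_integral => u _; exact: gaussian_xsection.
Qed.

Definition empirical_density n (S : n.-tuple (rvec R d)) (x : rvec R d) : R :=
  n%:R^-1 * \sum_(i < n) L (tnth S i) x.

Lemma integrable_empirical_density n (S : n.-tuple (rvec R d)) :
  rho.-integrable setT (EFin \o empirical_density S).
Proof.
rewrite (_ : _ \o _ =
    fun x => (n%:R^-1)%:E * (\sum_(i < n) (L (tnth S i) x)%:E))%E; last first.
  by apply/funext => x; rewrite /= EFinM -sumEFin.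
apply: integrableZl => //.
by apply: integrable_sum => // i _; exact: integrable_kernel_density_r.
Qed.

Lemma convolution_empirical_density n (S : n.-tuple (rvec R d)) A :
  measurable A ->
  convolution (empirical S) (gaussian d s) A
  = (\int[rho]_(x in shift_set m A) (empirical_density S x)%:E)%E.
Proof.
move=> mA; have mB := measurable_shift_set m mA.
pose f u := gaussian d s (xsection (@vadd R d @^-1` A) u).
have mf : measurable_fun setT f.
  apply: measurable_fun_xsection; rewrite -[X in measurable X]setTI.
  exact: measurable_vadd.
transitivity (\int[empirical S]_u f u)%E; first by [].
rewrite ge0_integral_empirical//.
under eq_integral do rewrite /empirical_density EFinM -sumEFin.
rewrite ge0_integralZl//.
- congr (_ * _)%E; rewrite ge0_integral_sum//.
  + by apply: eq_bigr => i _; exact: gaussian_xsection.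
  + move=> i; apply/measurable_EFinP/measurable_funTS.
    exact: measurable_kernel_density_r.
  + by move=> i x _; exact: (L0 (_, _)).
- apply: emeasurable_sum => i; apply/measurable_EFinP/measurable_funTS.
  exact: measurable_kernel_density_r.
- by move=> x _; apply: sume_ge0 => i _; exact: (L0 (_, _)).
Qed.

Lemma measurable_empirical_density n :
  measurable_fun [set: n.-tuple (rvec R d) * rvec R d]
    (fun z => empirical_density z.1 z.2).
Proof.
apply: measurable_funM => //; apply: measurable_sum => i.
have mt := measurableT_comp (@measurable_tnth _ (rvec R d) n i)
  (@measurable_fst _ _ _ (rvec R d)).
have mp := measurable_fun_pair mt (@measurable_snd _ _ _ (rvec R d)).
exact: (measurableT_comp measurable_kernel_density mp).
Qed.

(** By Tonelli, the mean square error may be computed pointwise in [x], where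
    it is that of an empirical mean. *)
Lemma integral_empirical_density_error n : (0 < n)%N ->
  (\int[power_prob P n]_S \int[rho]_x ((empirical_density S x - p x) ^+ 2)%:E
   <= (n%:R^-1)%:E * \int[P]_u \int[rho]_x (L u x ^+ 2)%:E)%E.
Proof.
move=> n0.
pose f (z : n.-tuple (rvec R d) * rvec R d) :=
  ((empirical_density z.1 z.2 - p z.2) ^+ 2)%:E.
have mf : measurable_fun setT f.
  apply/measurable_EFinP; apply: measurable_funX; apply: measurable_funB.
    exact: measurable_empirical_density.
  exact: (measurableT_comp measurable_smoothed_density
    (@measurable_snd _ _ _ (rvec R d))).
have f0 z : (0 <= f z)%E by rewrite lee_fin sqr_ge0.
have -> := @fubini_tonelli _ _ _ _ _ (power_prob P n) rho f mf f0.
have mL2 : measurable_fun [set: rvec R d * rvec R d]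
    (fun z => (L z.1 z.2 ^+ 2)%:E).
  apply/measurable_EFinP; apply: measurable_funX.
  exact: measurable_kernel_density.
have L20 (z : rvec R d * rvec R d) : (0 <= (L z.1 z.2 ^+ 2)%:E)%E.
  by rewrite lee_fin sqr_ge0.
have -> := @fubini_tonelli _ _ _ _ _ P rho _ mL2 L20.
rewrite -ge0_integralZl//; last 2 first.
- exact: (@measurable_fun_fubini_tonelli_G _ _ _ _ _ P _ mL2 L20).
- by move=> x _; apply: integral_ge0 => u _; exact: (L20 (_, _)).
apply: ge0_le_integralT => x; first by apply: integral_ge0 => S _; exact: f0.
exact: (integral_empirical_mean_sqr n0 (integrable_kernel_density_l x)
  (integrable_kernel_density_expn 2 x) (smoothed_densityE x)).
Qed.

End smoothed_densities.

(** * The numerical constant and the bound *)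

(** After [t / s <= sqrt 2 * (1 / sqrt 2 + K / s)] the claim is
    [sqrt 2 <= exp (3 / 8)]. *)
Lemma sqrt_ratio_le_constant (R : realType) (d : nat) (s t K : R) :
  0 < s -> 0 < t -> 0 < K ->
  t ^+ 2 = s ^+ 2 + K ^+ 2 *+ 2 ->
  Num.sqrt ((t / s) ^+ d) <=
  ((Num.sqrt 2)^-1 + K / s) `^ (d%:R / 2) * expR (3 * d%:R / 16).
Proof.
move=> s0 t0 K0 tE.
set q := Num.sqrt 2; set a := _ + _.
have q0 : 0 < q by rewrite sqrtr_gt0.
have q2 : q ^+ 2 = 2 by rewrite sqr_sqrtr.
have a0 : 0 < a by rewrite addr_gt0 ?invr_gt0 ?divr_gt0.
have e_ge : q <= expR (3 / 8).
  rewrite -ler_sqr ?nnegrE ?expR_ge0 ?(ltW q0)// q2 -expRM_natl.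
  (* [1 + x <= exp x] is too weak at [3 / 4], but the eighth power of its
     instance at [3 / 32] is enough: [(35 / 32)^8 > 2]. *)
  have -> : 2 * (3 / 8) = 8 * (3 / 32) :> R by field.
  rewrite expRM_natl.
  have h : 1 + 3 / 32 <= expR (3 / 32) :> R by exact: expR_ge1Dx.
  have h0 : 0 <= 1 + 3 / 32 :> R by lra.
  apply: (@le_trans _ _ ((1 + 3 / 32) ^+ 8)); first by lra.
  by rewrite lerXn2r// nnegrE expR_ge0.
have ts_le : t / s <= q * a.
  have k0 : 0 < K / s by rewrite divr_gt0.
  have ts0 : 0 < t / s by rewrite divr_gt0.
  rewrite -ler_sqr ?nnegrE ?(ltW ts0) ?mulr_ge0 ?(ltW q0) ?(ltW a0)//.
  have -> : (t / s) ^+ 2 = 1 + (K / s) ^+ 2 *+ 2.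
    by rewrite exprMn exprVn tE; field; rewrite gt_eqF.
  have -> : q * a = 1 + q * (K / s) by rewrite mulrDr divff// gt_eqF.
  rewrite sqrrD [(q * _) ^+ 2]exprMn q2 expr1n mul1r mulr_natl lerD2r lerDl.
  by rewrite mulrn_wge0// mulr_ge0// ltW.
have tsa : t / s <= a * expR (3 / 8).
  by apply: le_trans ts_le _; rewrite mulrC ler_wpM2l// ltW.
have ae0 : 0 <= a * expR (3 / 8) by rewrite mulr_ge0 ?expR_ge0 ?ltW.
apply: (@le_trans _ _ (Num.sqrt ((a * expR (3 / 8)) ^+ d))).
  by rewrite ler_sqrt ?exprn_ge0// lerXn2r// nnegrE// ltW// divr_gt0.
rewrite -powR12_sqrt ?exprn_ge0// -powR_mulrn// -powRrM.
rewrite powRM ?expR_ge0 ?(ltW a0)//.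
rewrite -expRM le_eqVlt; apply/orP; left; apply/eqP; congr (_ * expR _).
by field.
Qed.

Theorem proposition2 (R : realType) (d : nat) (sigma K : R)
  (P : probability (rvec R d) R) (n : nat) :
  (1 <= d)%N -> 0 < sigma -> 0 < K -> subgaussian K P -> (1 <= n)%N ->
  (\int[power_prob P n]_s
      tv_dist (convolution (empirical s) (gaussian d sigma))
              (convolution P (gaussian d sigma))
   <= (((Num.sqrt 2)^-1 + K / sigma) `^ (d%:R / 2)
       * expR (3 * d%:R / 16) * (Num.sqrt n%:R)^-1)%:E)%E.
Proof.
move=> _ s0 K0 subP n0.
have t20 : 0 < sigma ^+ 2 + K ^+ 2 *+ 2.
  by rewrite addr_gt0 ?mulrn_wgt0 ?exprn_gt0.
pose t := Num.sqrt (sigma ^+ 2 + K ^+ 2 *+ 2).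
have t0 : 0 < t by rewrite sqrtr_gt0.
have tE : t ^+ 2 = sigma ^+ 2 + K ^+ 2 *+ 2 by rewrite sqr_sqrtr// ltW.
have n0' : 0 < n%:R :> R by rewrite ltr0n.
pose c := Num.sqrt ((t / sigma) ^+ d) / Num.sqrt n%:R.
have ts0 : 0 < (t / sigma) ^+ d by rewrite exprn_gt0// divr_gt0.
have c0 : 0 < c by rewrite divr_gt0 ?sqrtr_gt0.
have c2 : c ^+ 2 = n%:R^-1 * (t / sigma) ^+ d.
  by rewrite exprMn exprVn !sqr_sqrtr ?ltW// mulrC.
pose p := smoothed_density sigma t P (mean P).
pose q (S : n.-tuple (rvec R d)) := empirical_density sigma t (mean P) S.
pose r (z : n.-tuple (rvec R d) * rvec R d) := q z.1 z.2 - p z.2.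
have mr : measurable_fun setT r.
  apply: measurable_funB; first exact: measurable_empirical_density.
  have mp : measurable_fun setT p by exact: measurable_smoothed_density.
  exact: (measurableT_comp mp (@measurable_snd _ _ _ (rvec R d))).
apply: (@le_trans _ _ c%:E); last first.
  rewrite lee_fin ler_wpM2r ?invr_ge0 ?sqrtr_ge0//.
  exact: sqrt_ratio_le_constant.
apply: (@le_trans _ _
    (\int[power_prob P n]_S \int[gaussian d t]_x `|r (S, x)|%:E)%E).
  apply: ge0_le_integralT => S.
    exact: tv_dist_ge0.
  apply: (tv_dist_density_le (phi := shift_set (mean P))).
  - by move=> A mA; exact: measurable_shift_set.
  - exact: integrable_empirical_density.
  - exact: integrable_smoothed_density.
  - by move=> A mA; exact: convolution_empirical_density.
  - by move=> A mA; exact: convolution_smoothed_density.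
have mr1 : measurable_fun setT (fun z => `|r z|%:E).
  by apply/measurable_EFinP; exact: measurableT_comp.
have mr2 : measurable_fun setT (fun z => (r z ^+ 2)%:E).
  by apply/measurable_EFinP; exact: measurable_funX.
have r10 z : (0 <= `|r z|%:E)%E by rewrite lee_fin.
have r20 z : (0 <= (r z ^+ 2)%:E)%E by rewrite lee_fin sqr_ge0.
have <- := @fubini_tonelli1 _ _ _ _ _ (power_prob P n) (gaussian d t) _ mr1 r10.
apply: integral_norm_le_of_sqr => //.
have -> := @fubini_tonelli1 _ _ _ _ _ (power_prob P n) (gaussian d t) _ mr2 r20.
apply: (le_trans (integral_empirical_density_error s0 t0 P (mean P) n0)).
rewrite c2 EFinM; apply: lee_pmul => //.
- apply: integral_ge0 => u _; apply: integral_ge0 => x _.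
  by rewrite lee_fin sqr_ge0.
- exact: (subgaussian_gaussian_lr_sqr s0 t0 tE subP).
Qed.
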